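(* Let $\Phi$ be an oriented surface in $\mathbb{R}^3$ with nowhere vanishing Gaussian curvature such that all the oriented unit normals are distinct from $(0,0,-1)$ and $\Phi^i$ is the graph of a $C^4$ function $f\colon D\to\mathbb{R}$ in a disk $D\subset\mathbb{R}^2$. If through each point of $\Phi$ there passes an oriented cylinder of fixed radius $R$ which is tangent to $\Phi$ along a continuous curve (containing the point), has inwards oriented normals and the axis nonparallel to the plane $z=0$, then for each $(x,y)\in D$ the three equations $$f_{xxx}v^3-3f_{xxy}v^2u+3f_{xyy}vu^2-f_{yyy}u^3+3(f_{xx}-f_{yy})uv+3f_{xy}(v^2-u^2)=0,$$ $$x^2+y^2+1+2xu+2yv=0,$$ $$2(u^2+v^2)(f-xf_x-yf_y-R)+(x^2+y^2+1)(f_{xx}v^2-2f_{xy}uv+f_{yy}u^2)=0$$ (with $f$ and its derivatives evaluated at $(x,y)$) have a common real solution $(u,v)$.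
   Context: An oriented surface is the image of a proper injective $C^2$ map of an open disk (or more generally of a smooth $2$-manifold) into $\mathbb{R}^3$ with nondegenerate differential at each point, equipped with oriented unit normals continuously depending on the point. Isotropic model: for an oriented plane $P$ with equation $n_1x+n_2y+n_3z+h=0$, where $(n_1,n_2,n_3)\neq(0,0,-1)$ is its oriented unit normal, let $P^i\in\mathbb{R}^3$ be the point $\left(\frac{n_1}{n_3+1},\frac{n_2}{n_3+1},\frac{h}{n_3+1}\right)$. For an oriented surface $\Phi$, $\Phi^i$ is the set of points $P^i$, where $P$ runs through all oriented tangent planes to $\Phi$ with oriented normals distinct from $(0,0,-1)$. Cylinders are cylinders of revolution. An oriented surface is tangent to $\Phi$ along a curve if the curve lies on both surfaces and their oriented tangent planes coincide at each point of the curve. *)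

(* Defs.v *)
From mathcomp Require Import all_boot all_order all_algebra.
From mathcomp Require Import all_classical all_reals all_analysis.

Set Implicit Arguments.
Unset Strict Implicit.
Unset Printing Implicit Defensive.

Import Order.TTheory GRing.Theory Num.Theory.
Import numFieldNormedType.Exports.

Local Open Scope classical_set_scope.
Local Open Scope ring_scope.

Notation plane R := (R * R)%type (only parsing).
Notation space3 R := (R * R * R)%type (only parsing).

Section Vectors.
Variable R : realType.
Implicit Types u v : space3 R.

Definition dot u v : R := u.1.1 * v.1.1 + u.1.2 * v.1.2 + u.2 * v.2.

(* The Euclidean norm: the library norm on products is the sup norm. *)
Definition enorm u : R := Num.sqrt (dot u u).

Definition disk (c : plane R) (r : R) : set (plane R) :=
  [set p | (p.1 - c.1) ^+ 2 + (p.2 - c.2) ^+ 2 < r ^+ 2].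

End Vectors.

Section Smoothness.
Variables (R : realType) (V : normedModType R).
Implicit Types (D : set (plane R)) (f : plane R -> V).

Definition pdx f : plane R -> V := 'D_((1, 0) : plane R) f.
Definition pdy f : plane R -> V := 'D_((0, 1) : plane R) f.

(* Meant for open D, where derivatives only depend on the values of f on D. *)
Fixpoint Ck (k : nat) D f : Prop :=
  match k with
  | 0%N => forall p, D p -> {for p, continuous f}
  | k'.+1 => [/\ forall p, D p -> differentiable f p,
                 Ck k' D (pdx f) & Ck k' D (pdy f)]
  end.

Definition smooth D f : Prop := forall k, Ck k D f.

End Smoothness.

(* A smooth 2-manifold: a second-countable Hausdorff space with a smooth atlas.
   The i-th chart is the homeomorphism [coord i] from the open set [dom i] onto
   an open subset of the plane, with inverse [param i]; both maps are totalized
   by arbitrary values outside of these sets. *)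
Record manifold2 (R : realType) := Manifold2 {
  points :> topologicalType;
  points_hausdorff : hausdorff_space points;
  points_second_countable : @second_countable points;
  chart : Type;
  dom : chart -> set points;
  coord : chart -> points -> plane R;
  param : chart -> plane R -> points;
  dom_open : forall i, open (dom i);
  dom_cover : forall m, exists i, dom i m;
  coordK : forall i m, dom i m -> param i (coord i m) = m;
  coord_image_open : forall i, open (coord i @` dom i);
  coord_continuous : forall i, {within dom i, continuous (coord i)};
  param_continuous : forall i,
    {within coord i @` dom i, continuous (param i)};
  transition_smooth : forall i j,
    smooth (coord i @` (dom i `&` dom j)) (coord j \o param i)
}.

Definition chart_image (R : realType) (M : manifold2 R) (i : chart M) :
  set (plane R) := coord i @` dom i.

(* A set of points of space with a field of vectors, meaningful on this set. *)
Record normal_field_set (R : realType) := NormalFieldSet {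
  carrier : set (space3 R);
  normal : space3 R -> space3 R
}.

(* The image of a proper injective C^2 immersion of a smooth 2-manifold (an open
   disk in particular), with continuous unit normals. *)
Record oriented_surface (R : realType) := OrientedSurface {
  source : manifold2 R;
  immersion : source -> space3 R;
  unit_normal : space3 R -> space3 R;
  immersion_proper : forall K, compact K -> compact (immersion @^-1` K);
  immersion_inj : injective immersion;
  immersion_C2 : forall i : chart source,
    Ck 2 (chart_image i) (immersion \o param i);
  immersion_nondegenerate : forall (i : chart source) p, chart_image i p ->
    injective ('d (immersion \o param i) p);
  unit_normal_unit : forall q, range immersion q -> enorm (unit_normal q) = 1;
  unit_normal_orthogonal : forall (i : chart source) p, chart_image i p ->
    forall w, dot (unit_normal (immersion (param i p)))
                  ('d (immersion \o param i) p w) = 0;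
  unit_normal_continuous : {within range immersion, continuous unit_normal}
}.

Definition surface_set (R : realType) (Phi : oriented_surface R) :
  normal_field_set R := NormalFieldSet (range (@immersion R Phi)) (@unit_normal R Phi).

Coercion surface_set : oriented_surface >-> normal_field_set.

Section Curvature.
Variable R : realType.

(* (L N - M ^ 2) / (E G - F ^ 2) for a local parametrization s with unit
   normal n at s p. *)
Definition gauss_curvature (s : plane R -> space3 R) (n : space3 R)
    (p : plane R) : R :=
  let su := pdx s p in
  let sv := pdy s p in
  (dot (pdx (pdx s) p) n * dot (pdy (pdy s) p) n
     - dot (pdy (pdx s) p) n ^+ 2)
  / (dot su su * dot sv sv - dot su sv ^+ 2).

Definition nowhere_vanishing_curvature (Phi : oriented_surface R) : Prop :=
  forall (i : chart (source Phi)) p, chart_image i p ->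
    gauss_curvature (@immersion R Phi \o param i)
      (normal Phi (immersion (param i p))) p != 0.

End Curvature.

Section IsotropicModel.
Variable R : realType.

(* The oriented plane n_1 x + n_2 y + n_3 z + h = 0 is encoded by (n, h). *)
Definition oriented_plane : Type := (space3 R * R)%type.

Definition tangent_plane (S : normal_field_set R) (q : space3 R) :
  oriented_plane := (normal S q, - dot (normal S q) q).

Definition south : space3 R := (0, 0, -1).

Definition isotropic_point (P : oriented_plane) : space3 R :=
  let: (n, h) := P in
  (n.1.1 / (n.2 + 1), n.1.2 / (n.2 + 1), h / (n.2 + 1)).

Definition isotropic_image (S : normal_field_set R) : set (space3 R) :=
  [set isotropic_point (tangent_plane S q) |
     q in [set q | carrier S q /\ normal S q <> south]].

Definition graph_on (D : set (plane R)) (f : plane R -> R) : set (space3 R) :=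
  [set (p, f p) | p in D].

End IsotropicModel.

Section Tangency.
Variable R : realType.

(* The image of an interval under a nonconstant continuous map. *)
Definition continuous_curve (C : set (space3 R)) : Prop :=
  exists (I : interval R) (gamma : R -> space3 R),
    [/\ {within [set` I], continuous gamma},
        exists s t, [/\ s \in I, t \in I & gamma s <> gamma t] &
        C = gamma @` [set` I]].

Definition tangent_along (S S' : normal_field_set R) (C : set (space3 R)) :
  Prop :=
  [/\ C `<=` carrier S, C `<=` carrier S' &
      forall q, C q -> tangent_plane S q = tangent_plane S' q].

(* Orthogonal projection onto the line through a with unit direction w. *)
Definition axis_proj (a w q : space3 R) : space3 R := a + dot (q - a) w *: w.

Definition inward_cylinder (a w : space3 R) (r : R) : normal_field_set R :=
  NormalFieldSet [set q | enorm (q - axis_proj a w q) = r]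
                 (fun q => r^-1 *: (axis_proj a w q - q)).

End Tangency.

(* Main.v *)
(** Along the contact curve the oriented tangent planes of [Phi] are tangent
    planes of a cylinder, and in the isotropic model the latter form a curve
    over a circle [K] (this uses that the axis is not horizontal) on which the
    height is an affine function [rad + al x + be y].  If the projection of the
    contact curve to [K] were a single point, the normal of [Phi] would be
    constant along the curve, although a nonvanishing curvature makes the Gauss
    map locally injective.  So [f] is affine on a connected subset of [K] with
    more than one point.  Differentiating [f - rad - al x - be y] three times
    along [K] gives three relations: the third derivative yields the cubic
    equation, and the first two, which determine [al] and [be], yield the
    equation containing [rad].  The solution [(u, v)] is the vector from
    [(x, y)] to the centre of [K]. *)

From HB Require Import structures.
Require Import Defs.
From mathcomp Require Import all_boot all_order all_algebra.
From mathcomp Require Import all_classical all_reals all_analysis.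
From mathcomp Require Import ring lra.

Set Implicit Arguments.
Unset Strict Implicit.
Unset Printing Implicit Defensive.

Import Order.TTheory GRing.Theory Num.Theory.
Import numFieldNormedType.Exports.
Local Open Scope classical_set_scope.
Local Open Scope ring_scope.

(** * First-order analysis of functions of two real variables *)

Section PlaneDifferential.
Variable R : realType.
Implicit Types (a b g : plane R -> R) (p e q : plane R).

Lemma diff_pd (V : normedModType R) (g : plane R -> V) p (h k : R) :
  differentiable g p -> 'd g p (h, k) = h *: pdx g p + k *: pdy g p.
Proof.
move=> dg; rewrite /pdx /pdy !deriveE// -!linearZ -linearD; congr ('d g p _).
by apply/pair_equal_spec; split;
  [change (h = h * 1 + k * 0)|change (k = h * 0 + k * 1)]; ring.
Qed.

(** The little-o remainder is relative to the sup norm of the increment, which is at most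
    [|h| + |k|]. *)
Lemma differentiable_expansion a p (eps : R) : differentiable a p -> 0 < eps ->
  exists2 delta : R, 0 < delta & forall h k, `|h| < delta -> `|k| < delta ->
    `|a (p.1 + h, p.2 + k) - a p - (h * pdx a p + k * pdy a p)|
       <= eps * (`|h| + `|k|).
Proof.
move=> da eps0.
have /funext E := diff_locallyxC da.
have /(_ _ eps0) := @eqadd_some_oP _ _ _ _ _ (fun h => a (p + h))
  (fun h => a p + 'd a p h) id _ E.
move=> /nbhs_ballP[delta d0 H]; exists delta => // h k hd kd.
have := H (h, k); rewrite -ball_normE /ball_/= sub0r normrN /=.
rewrite prod_normE/= gt_max hd kd => /(_ isT).
set N := (N in _ <= eps * N); rewrite !fctE.
have -> : p + (h, k) = (p.1 + h, p.2 + k) by case: (p).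
rewrite (diff_pd h k da) opprD addrA => H1.
rewrite opprD addrA in H1 *.
apply: (le_trans H1); rewrite ler_pM2l// /N ge_max/=.
by rewrite lerDl lerDr !normr_ge0.
Qed.

Lemma is_derive_along (g : plane R -> R) (p v : plane R) (s : R) :
  differentiable g (p + s *: v) ->
  is_derive s 1 (fun t => g (p + t *: v)) ('D_v g (p + s *: v)).
Proof.
move=> dg.
have dl : is_diff s (fun t : R => p + t *: v) (fun t => t *: v).
  rewrite -[X in is_diff _ _ X]add0r.
  exact: (@is_diffD _ _ _ (cst p) (fun t : R => t *: v)).
have H := @is_diff_comp _ _ _ _ _ _ _ _ s dl (differentiableP dg).
apply: DeriveDef.
  by apply/derivable1_diffP; case: H.
rewrite deriveE; last by case: H.
by rewrite (@diff_val _ _ _ _ _ _ _ H) /= scale1r deriveE.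
Qed.

(** The mean value theorem for the difference of the restrictions of [g] to two parallel segments;
    it turns a second difference of [g] into a first difference of a directional derivative. *)
Lemma mvt_increment g p p' (v : plane R) (t : R) : 0 < t ->
  (forall s, 0 <= s <= t ->
     differentiable g (p + s *: v) /\ differentiable g (p' + s *: v)) ->
  exists2 s, 0 < s < t &
    (g (p + t *: v) - g p) - (g (p' + t *: v) - g p')
      = t * ('D_v g (p + s *: v) - 'D_v g (p' + s *: v)).
Proof.
move=> t0 dg.
have H s : 0 <= s <= t ->
    is_derive s 1 (fun t => g (p + t *: v) - g (p' + t *: v))
                  ('D_v g (p + s *: v) - 'D_v g (p' + s *: v)).
  move=> /dg[d1 d2]; exact: is_deriveB (is_derive_along d1) (is_derive_along d2).
have [||s] := @MVT R (fun t => g (p + t *: v) - g (p' + t *: v))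
    (fun s => 'D_v g (p + s *: v) - 'D_v g (p' + s *: v)) 0 t t0.
- by move=> s; rewrite in_itv/= => /andP[/ltW s0 /ltW st]; apply: H; rewrite s0.
- by apply: derivable_within_continuous => s; rewrite in_itv/= => /H[].
rewrite in_itv/= => st; rewrite !scale0r !addr0 subr0 => E.
by exists s => //; rewrite mulrC -E; ring.
Qed.

(** Symmetry of second derivatives in Young's form. The second difference of [g] over a square of
    side [t] is [t] times an increment of [a] and also [t] times an increment of [b]; expanding both
    at [p] to first order bounds [t * (pdy a p - pdx b p)] by [t * eps]. *)
Lemma mixed_pd_sym g a b p :
  (\forall q \near p, [/\ differentiable g q, pdx g q = a q & pdy g q = b q]) ->
  differentiable a p -> differentiable b p -> pdy a p = pdx b p.
Proof.
move=> /nbhs_ballP[r /= r0 near_p] da db.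
have gP h k : `|h| < r -> `|k| < r ->
    [/\ differentiable g (p.1 + h, p.2 + k),
        pdx g (p.1 + h, p.2 + k) = a (p.1 + h, p.2 + k) &
        pdy g (p.1 + h, p.2 + k) = b (p.1 + h, p.2 + k)].
  move=> hr kr; apply: near_p; split; rewrite /ball/= opprD addNKr normrN//.
apply/eqP; rewrite -subr_eq0 -normr_le0; apply/ler_addgt0Pr => eps eps0.
(* The four expansion errors below sum to at most [6 * t] times this constant, as [s] and [s'] lie
   between 0 and [t]. *)
rewrite add0r; have e8 : 0 < eps / 8 by lra.
have [r1 r10 Ha] := differentiable_expansion da e8.
have [r2 r20 Hb] := differentiable_expansion db e8.
pose t := Num.min r (Num.min r1 r2) / 2.
have m0 : 0 < Num.min r (Num.min r1 r2) by rewrite !lt_min r0 r10.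
have t0 : 0 < t by rewrite /t; lra.
have [tr tr1 tr2] : [/\ t < r, t < r1 & t < r2].
  have : t < Num.min r (Num.min r1 r2) by rewrite /t; lra.
  by rewrite !lt_min => /and3P[].
have small s : 0 <= s <= t -> [/\ `|s| < r, `|s| < r1 & `|s| < r2].
  move=> /andP[s0 st]; rewrite ger0_norm//.
  by split; apply: le_lt_trans st _.
have xE (x y s : R) : (x, y) + s *: ((1, 0) : plane R) = (x + s, y).
  by apply/pair_equal_spec; split;
    [change (x + s * 1 = x + s)|change (y + s * 0 = y)]; ring.
have yE (x y s : R) : (x, y) + s *: ((0, 1) : plane R) = (x, y + s).
  by apply/pair_equal_spec; split;
    [change (x + s * 0 = x)|change (y + s * 1 = y + s)]; ring.
have n0 (x : R) : 0 < x -> `|0 : R| < x by rewrite normr0.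
have nt : `|t| = t by rewrite gtr0_norm.
have [|s s0t] := @mvt_increment g (p.1, p.2 + t) (p.1, p.2) (1, 0) t t0.
  move=> s /small[sr _ _]; rewrite !xE; split.
    by have [] := gP s t; rewrite ?nt.
  by have [] := gP s 0 sr; rewrite ?addr0// n0.
have [|s' s'0t] := @mvt_increment g (p.1 + t, p.2) (p.1, p.2) (0, 1) t t0.
  move=> s' /small[sr _ _]; rewrite !yE; split.
    by have [] := gP t s'; rewrite ?nt.
  by have [] := gP 0 s' (n0 _ r0) sr; rewrite ?addr0// n0.
rewrite !xE !yE -/(pdx g _) -/(pdy g _) => Es' Es.
have {}s0t : 0 <= s <= t by case/andP: s0t => /ltW -> /ltW ->.
have {}s'0t : 0 <= s' <= t by case/andP: s'0t => /ltW -> /ltW ->.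
have [sr sr1 _] := small _ s0t; have [sr' _ sr2'] := small _ s'0t.
(* Both sides are the second difference of [g] over the same square. *)
have {Es Es'} : t * (pdx g (p.1 + s, p.2 + t) - pdx g (p.1 + s, p.2))
    = t * (pdy g (p.1 + t, p.2 + s') - pdy g (p.1, p.2 + s')).
  by rewrite -Es -Es'; ring.
move/(mulfI (lt0r_neq0 t0)).
have trn : `|t| < r by rewrite nt.
have [_ -> _] := gP s t sr trn.
have := gP s 0 sr (n0 _ r0); rewrite addr0 => -[_ -> _].
have [_ _ ->] := gP t s' trn sr'.
have := gP 0 s' (n0 _ r0) sr'; rewrite addr0 => -[_ _ ->] ab.
have := Ha s t sr1; rewrite nt => /(_ tr1) Ha1.
have := Ha s 0 sr1 (n0 _ r10); rewrite addr0 normr0 mul0r !addr0 => Ha2.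
have := Hb t s'; rewrite nt => /(_ tr2 sr2') Hb1.
have := Hb 0 s' (n0 _ r20) sr2'; rewrite addr0 normr0 mul0r !add0r => Hb2.
have ns : `|s| <= t by case/andP: s0t => s0 ?; rewrite ger0_norm.
have ns' : `|s'| <= t by case/andP: s'0t => s0 ?; rewrite ger0_norm.
have : t * (pdy a p - pdx b p) =
  - (a (p.1 + s, p.2 + t) - a p - (s * pdx a p + t * pdy a p))
   + (a (p.1 + s, p.2) - a p - s * pdx a p)
   + (b (p.1 + t, p.2 + s') - b p - (t * pdx b p + s' * pdy b p))
   - (b (p.1, p.2 + s') - b p - s' * pdy b p).
  apply: subr0_eq.
  rewrite -[RHS](subrr (b (p.1 + t, p.2 + s') - b (p.1, p.2 + s'))) -{1}ab.
  by ring.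
move=> /(congr1 Num.norm); rewrite normrM nt => E.
have tri (w x y z : R) : `|- w + x + y - z| <= `|w| + `|x| + `|y| + `|z|.
  rewrite (le_trans (ler_normD _ _))// normrN lerD2r.
  rewrite (le_trans (ler_normD _ _))// lerD2r.
  by rewrite (le_trans (ler_normD _ _))// normrN.
have : t * `|pdy a p - pdx b p| <= t * eps.
  rewrite E; apply: le_trans (tri _ _ _ _) _.
  apply: le_trans (lerD (lerD (lerD Ha1 Ha2) Hb1) Hb2) _.
  rewrite -!mulrDr (_ : t * eps = eps / 8 * (t * 8)); last by field.
  rewrite ler_wpM2l ?(ltW e8)//.
  by move: t0 ns ns'; clear; lra.
by rewrite ler_pM2l.
Qed.

(** Cramer's rule: the determinant times a coordinate of [q - p] is a combination of the two linear
    parts, which at a common zero are as small as the remainders. This gives [m <= m / 2] for the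
    size [m] of [q - p]. *)
Lemma zero_isolated (G1 G2 : plane R -> R) p :
  differentiable G1 p -> differentiable G2 p -> G1 p = 0 -> G2 p = 0 ->
  pdx G1 p * pdy G2 p - pdy G1 p * pdx G2 p != 0 ->
  \forall q \near p, G1 q = 0 -> G2 q = 0 -> q = p.
Proof.
set A1 := pdx G1 p; set B1 := pdy G1 p; set A2 := pdx G2 p; set B2 := pdy G2 p.
move=> d1 d2 G10 G20 det0.
pose S := `|A1| + `|A2| + `|B1| + `|B2| + 1.
have S0 : 0 < S.
  by rewrite /S ltr_wpDl// !addr_ge0.
(* With this value the two Cramer bounds add up to at most [m / 2] times the absolute value of the
   determinant. *)
have eps0 : 0 < `|A1 * B2 - B1 * A2| / (S * 2).
  by rewrite divr_gt0 ?mulr_gt0 ?normr_gt0.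
set eps := _ / _ in eps0.
have [r1 r10 H1] := differentiable_expansion d1 eps0.
have [r2 r20 H2] := differentiable_expansion d2 eps0.
apply/nbhs_ballP; exists (Num.min r1 r2); first by rewrite /= lt_min r10.
move=> q [/=]; rewrite /ball/= [`|p.1 - _|]distrC [`|p.2 - _|]distrC !lt_min.
move=> /andP[q11 q12] /andP[q21 q22] Gq1 Gq2.
pose h := q.1 - p.1; pose k := q.2 - p.2.
have E : (p.1 + h, p.2 + k) = q by rewrite /h /k !subrKC; case: (q).
have := H1 h k; rewrite E Gq1 G10 => /(_ q11 q21).
have := H2 h k; rewrite E Gq2 G20 => /(_ q12 q22).
rewrite -/A1 -/A2 -/B1 -/B2.
rewrite !subrr !sub0r !normrN => Q2 Q1; set m := `|h| + `|k| in Q1 Q2.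
have hE : h = 0 -> k = 0 -> q = p.
  move=> h0 k0; move: E; rewrite h0 k0 !addr0 => <-; by case: (p).
clear H1 H2 q11 q12 q21 q22 d1 d2; clearbody A1 A2 B1 B2 h k.
have m0 : 0 <= m by rewrite /m addr_ge0.
have Dh : `|A1 * B2 - B1 * A2| * `|h| <= (`|B1| + `|B2|) * (eps * m).
  rewrite -normrM.
  rewrite (_ : _ * h = B2 * (h * A1 + k * B1) - B1 * (h * A2 + k * B2)).
    2: by ring.
  rewrite (le_trans (ler_normB _ _))// addrC [leRHS]mulrDl !normrM.
  by rewrite lerD// ler_wpM2l.
have Dk : `|A1 * B2 - B1 * A2| * `|k| <= (`|A1| + `|A2|) * (eps * m).
  rewrite -normrM.
  rewrite (_ : _ * k = A1 * (h * A2 + k * B2) - A2 * (h * A1 + k * B1)).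
    2: by ring.
  rewrite (le_trans (ler_normB _ _))// [leRHS]mulrDl !normrM.
  by rewrite lerD// ler_wpM2l.
have : `|A1 * B2 - B1 * A2| * m <= `|A1 * B2 - B1 * A2| * (m / 2).
  rewrite {1}/m mulrDr; apply: le_trans (lerD Dh Dk) _.
  rewrite -mulrDl (_ : _ * (m / 2) = S * (eps * m)); last first.
    by rewrite /eps; field; rewrite gt_eqF.
  have S_ge : `|B1| + `|B2| + (`|A1| + `|A2|) <= S.
    by rewrite /S; clear; lra.
  by rewrite ler_wpM2r// mulr_ge0// ltW.
rewrite ler_pM2l ?normr_gt0// => mle.
have {mle} mz : m = 0 by clear -mle m0; lra.
have : `|h| + `|k| == 0 by rewrite -/m mz.
by rewrite paddr_eq0// !normr_eq0 => /andP[/eqP h0 /eqP]; exact: hE.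
Qed.

(* Points of [E] near [e] lie on a circle, hence accumulate at [e] only in the
   tangent direction. *)
Lemma tangent_derivative0 (E : set (plane R)) g (c1 c2 k0 : R) e :
  (forall q, E q -> q.1 ^+ 2 + q.2 ^+ 2 - 2 * q.1 * c1 - 2 * q.2 * c2 = k0) ->
  (forall q, E q -> g q = 0) -> E e ->
  (forall r, 0 < r -> exists q,
     [/\ E q, q <> e, `|q.1 - e.1| < r & `|q.2 - e.2| < r]) ->
  differentiable g e ->
  - (e.2 - c2) * pdx g e + (e.1 - c1) * pdy g e = 0.
Proof.
move=> circ g0 Ee lim_e dg.
set V := e.2 - c2; set U := e.1 - c1; set A := pdx g e; set B := pdy g e.
(* For a circle of radius zero both coefficients vanish. *)
have [r2z|r2nz] := eqVneq (U ^+ 2 + V ^+ 2) 0.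
  move: r2z => /eqP; rewrite paddr_eq0 ?sqr_ge0// !sqrf_eq0.
  move=> /andP[/eqP-> /eqP->].
  by rewrite oppr0 !mul0r addr0.
have r2gt0 : 0 < U ^+ 2 + V ^+ 2.
  by rewrite lt_neqAle eq_sym r2nz addr_ge0 ?sqr_ge0.
pose r := Num.sqrt (U ^+ 2 + V ^+ 2).
have rE : r ^+ 2 = U ^+ 2 + V ^+ 2 by rewrite sqr_sqrtr// ltW.
have r0 : 0 < r by rewrite sqrtr_gt0.
apply/eqP/negPn/negP => T0; set T := (X in X != 0) in T0.
have nT0 : 0 < `|T| by rewrite normr_gt0.
pose C := `|A * U + B * V|.
have C0 : 0 <= C by rewrite normr_ge0.
have eps0 : 0 < `|T| / (8 * r) by rewrite divr_gt0// mulr_gt0.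
set eps := _ / _ in eps0.
have [d d0 H] := differentiable_expansion dg eps0.
(* The first bound validates the expansion, the second yields [C * m <= |T| * r / 4], the third
   yields [m < r]. *)
pose d' := Num.min d (Num.min (`|T| * r / (8 * (C + 1))) (r / 2)).
have d'0 : 0 < d'.
  rewrite !lt_min d0 /= !divr_gt0 ?mulr_gt0//; lra.
have [q [Eq qe]] := lim_e d' d'0.
rewrite !lt_min => /and3P[hd hT hr] /and3P[kd kT kr].
set h := q.1 - e.1 in hd hT hr; set k := q.2 - e.2 in kd kT kr.
have qE : (e.1 + h, e.2 + k) = q by rewrite /h /k !subrKC; case: (q).
have := H h k hd kd; rewrite qE (g0 _ Eq) (g0 _ Ee) subrr sub0r normrN -/A -/B.
set m := _ + `|k| => Hm.
have m0 : 0 < m.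
  rewrite lt_neqAle addr_ge0// andbT eq_sym paddr_eq0// !normr_eq0 !subr_eq0.
  apply/negP => /andP[/eqP e1 /eqP e2]; apply: qe.
  by rewrite (surjective_pairing q) e1 e2; case: (e).
(* Subtracting the circle equations at [q] and [e] shows that the radial part of the increment is
   quadratic in it. *)
have circd : U * h + V * k = - (h ^+ 2 + k ^+ 2) / 2.
  have := circ _ Eq; rewrite -(circ _ Ee) -qE /U /V /=; clear; lra.
(* [tau] is [r] times the tangential component of the increment; Lagrange's identity and [circd]
   bound it below by a multiple of [m]. *)
pose tau := - V * h + U * k.
have nm : h ^+ 2 + k ^+ 2 <= m ^+ 2.
  rewrite -(real_normK (num_real h)) -(real_normK (num_real k)) /m.
  by have := mulr_ge0 (normr_ge0 h) (normr_ge0 k); clear; lra.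
have mn : m ^+ 2 <= 2 * (h ^+ 2 + k ^+ 2).
  rewrite -(real_normK (num_real h)) -(real_normK (num_real k)) /m.
  by have := sqr_ge0 (`|h| - `|k|); clear; lra.
have mr : m < r by rewrite /m; lra.
have tauE : tau ^+ 2 = r ^+ 2 * (h ^+ 2 + k ^+ 2) - (h ^+ 2 + k ^+ 2) ^+ 2 / 4.
  have -> : tau ^+ 2 = (U ^+ 2 + V ^+ 2) * (h ^+ 2 + k ^+ 2)
                       - (U * h + V * k) ^+ 2.
    by rewrite /tau; ring.
  by rewrite circd rE; field.
have tau_ge : r * m / 2 <= `|tau|.
  rewrite -[leLHS]ger0_norm; last by rewrite divr_ge0 ?mulr_ge0// ltW.
  rewrite -ler_sqr ?nnegrE// !real_normK ?num_real// tauE.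
  have nr : h ^+ 2 + k ^+ 2 <= r ^+ 2.
    by apply: le_trans nm _; rewrite ler_sqr ?nnegrE// ltW.
  have nn : 0 <= h ^+ 2 + k ^+ 2 by rewrite addr_ge0 ?sqr_ge0.
  have r20 : 0 <= r ^+ 2 by rewrite sqr_ge0.
  rewrite (_ : (r * m / 2) ^+ 2 = r ^+ 2 * m ^+ 2 / 4); last by field.
  move: (h ^+ 2 + k ^+ 2) (r ^+ 2) (m ^+ 2) nr nn r20 mn.
  move=> n s m2 sn n_ge0 s_ge0 m2n.
  have := mulr_ge0 s_ge0 n_ge0; have sn' : 0 <= s - n by rewrite subr_ge0.
  have := mulr_ge0 n_ge0 sn'; have m2n' : 0 <= 2 * n - m2 by rewrite subr_ge0.
  have := mulr_ge0 s_ge0 m2n'; clear; lra.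
(* The tangential product is [r ^ 2] times the full scalar product of gradient and increment, minus
   the radial product. The former is small because [g] vanishes at [e] and [q], the latter by
   [circd]. *)
have key : `|T| * `|tau| <= C * (m ^+ 2 / 2) + r ^+ 2 * (eps * m).
  rewrite -normrM.
  have -> : T * tau = - ((A * U + B * V) * (U * h + V * k)) +
      r ^+ 2 * (h * A + k * B) by rewrite rE /T /tau; ring.
  rewrite (le_trans (ler_normD _ _))// normrN lerD//.
    rewrite normrM circd ler_wpM2l// normrM normrN.
    rewrite [X in X * _]ger0_norm ?addr_ge0 ?sqr_ge0//.
    by rewrite ger0_norm ?invr_ge0//; lra.
  by rewrite normrM ger0_norm ?sqr_ge0// ler_wpM2l ?sqr_ge0.
have {key} : `|T| * (r * m / 2) <= (C * m / 2 + r ^+ 2 * eps) * m.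
  apply: le_trans (_ : `|T| * `|tau| <= _); first by rewrite ler_wpM2l.
  by apply: (le_trans key); rewrite le_eqVlt; apply/orP; left; apply/eqP; field.
rewrite (_ : _ * (_ / 2) = (`|T| * r / 2) * m); last by field.
rewrite ler_pM2r// => key.
have e1 : r ^+ 2 * eps = `|T| * r / 8 by rewrite /eps; field; rewrite gt_eqF.
have e2 : C * m <= `|T| * r / 4.
  have : m <= `|T| * r / (4 * (C + 1)).
    rewrite (_ : _ / _ = `|T| * r / (8 * (C + 1)) + `|T| * r / (8 * (C + 1))).
      by rewrite /m; lra.
    by field; lra.
  rewrite ler_pdivlMr; last lra.
  nra.
have : 0 < `|T| * r by rewrite mulr_gt0.
lra.
Qed.

End PlaneDifferential.

(** * Differentials of coordinate projections and of scalar products *)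

Section Projections.
Variable R : realType.

Lemma is_diff_fst (U V : normedModType R) (p : U * V) :
  is_diff p (fst : U * V -> U) (fst : U * V -> U).
Proof.
have c : continuous (fst : U * V -> U) by move=> q; exact: cvg_fst.
apply: DiffDef; first exact: (@linear_differentiable R (U * V)%type _ fst p c).
exact: (@diff_lin R (U * V)%type _ fst p c).
Qed.

Lemma is_diff_snd (U V : normedModType R) (p : U * V) :
  is_diff p (snd : U * V -> V) (snd : U * V -> V).
Proof.
have c : continuous (snd : U * V -> V) by move=> q; exact: cvg_snd.
apply: DiffDef; first exact: (@linear_differentiable R (U * V)%type _ snd p c).
exact: (@diff_lin R (U * V)%type _ snd p c).
Qed.

Lemma is_derive_fst (U V : normedModType R) (p w : U * V) :
  is_derive p w (fst : U * V -> U) w.1.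
Proof.
have [d E] := is_diff_fst p.
by apply: DeriveDef; [exact: diff_derivable|rewrite deriveE// E].
Qed.

Lemma is_derive_snd (U V : normedModType R) (p w : U * V) :
  is_derive p w (snd : U * V -> V) w.2.
Proof.
have [d E] := is_diff_snd p.
by apply: DeriveDef; [exact: diff_derivable|rewrite deriveE// E].
Qed.

Lemma dotC (u v : space3 R) : dot u v = dot v u.
Proof. by rewrite /dot; ring. Qed.

Lemma dot_continuous (n : space3 R) : continuous (fun w => dot w n).
Proof.
move=> w; rewrite /dot; apply: cvgD; [apply: cvgD|]; apply: cvgMl.
- exact: (@continuous_comp _ _ _ fst fst w
    (@cvg_fst _ _ _ _ _) (@cvg_fst _ _ _ _ _)).
- exact: (@continuous_comp _ _ _ fst snd w
    (@cvg_fst _ _ _ _ _) (@cvg_snd _ _ _ _ _)).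
- exact: cvg_snd.
Qed.

Lemma is_diff_dot (V : normedModType R) (a : V -> space3 R) (n : space3 R)
    (p : V) :
  differentiable a p ->
  is_diff p (fun q => dot (a q) n) (fun w => dot ('d a p w) n).
Proof.
move=> da.
have Llin : linear (fun w : space3 R => dot w n : R).
  by move=> c u v; rewrite /dot /= /GRing.scale/=; ring.
pose LM := GRing.isLinear.Build _ _ _ _ _ Llin.
pose L : {linear space3 R -> R} := HB.pack (fun w : space3 R => dot w n : R) LM.
have cL : continuous L by exact: dot_continuous.
have dL : is_diff (a p) L L.
  by apply: DiffDef; [exact: linear_differentiable|exact: diff_lin].
exact: (@is_diff_comp _ _ _ _ _ _ _ _ p (differentiableP da) dL).
Qed.

Lemma derive_dot (V : normedModType R) (a : V -> space3 R) (n : space3 R)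
    (p v : V) :
  differentiable a p ->
  'D_v (fun q => dot (a q) n) p = dot ('D_v a p) n.
Proof.
move=> da; have [d1 d2] := is_diff_dot n da.
by rewrite !deriveE// d2.
Qed.

End Projections.

(** * Continuous maps on an interval *)

Section Interval.
Variable R : realType.
Implicit Types (I : interval R).

(** The fibre of [g] through [t0] is open in the interval by the local hypothesis, and closed
    because points of a Hausdorff space are closed; connectedness concludes. *)
Lemma constant_on_interval (T : topologicalType) I (g : R -> T) (t0 : R) :
  hausdorff_space T -> {within [set` I], continuous g} -> t0 \in I ->
  (forall s, s \in I -> g s = g t0 ->
     \forall u \near s, u \in I -> g u = g t0) ->
  forall s, s \in I -> g s = g t0.
Proof.
move=> hT /subspace_continuousP gc It0 loc.
pose B := [set` I] `&` [set u | g u = g t0].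
have cI : connected [set` I] by apply/connected_intervalP/interval_is_interval.
suff BI : B = [set` I] by move=> s sI; have [] : B s by rewrite BI.
apply: cI; first by exists t0; split.
(* The condition is vacuous outside the interval, so this interior is an open subset of the line
   whose trace on the interval is [B]. *)
- exists ([set u | u \in I -> g u = g t0]°); first exact: open_interior.
  apply/seteqP; split=> u [Iu gu]; split=> //.
    exact: loc.
  by move/interior_subset: gu => /=; apply.
- exists (closure B); first exact: closed_closure.
  apply/seteqP; split=> u [Iu gu]; split=> //; first exact: subset_closure.
  apply/eqP/negPn/negP => /eqP gu0.
  have cl : closed [set g t0] by exact/accessible_closed_set1/hausdorff_accessible.
  have /(gc u Iu) : nbhs (g u) (~` [set g t0]).
    by apply: open_nbhs_nbhs; split; [exact: closed_openC|].
  move=> /gu[v [[Iv gv] nv]].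
  exact: nv Iv gv.
Qed.

(** The fibre over an isolated value would be open, forcing [g] to be constant. This supplies the
    accumulating points for [tangent_derivative0]. *)
Lemma interval_image_perfect I (g : R -> plane R) :
  {within [set` I], continuous g} ->
  (exists s t, [/\ s \in I, t \in I & g s <> g t]) ->
  forall s, s \in I -> forall r, 0 < r -> exists t,
    [/\ t \in I, g t <> g s, `|(g t).1 - (g s).1| < r & `|(g t).2 - (g s).2| < r].
Proof.
move=> gc [s1 [s2 [Is1 Is2 g12]]] s Is r r0.
apply: contrapT => no; apply: g12.
suff H u : u \in I -> g u = g s by rewrite !H.
have hT := @norm_hausdorff R (plane R).
apply: (constant_on_interval hT gc Is) => //.
move=> v Iv gvs.
have : \forall u \near v, u \in I -> ball (g v) r (g u).
  by move/subspace_continuousP: gc => /(_ v Iv _ (nbhsx_ballx (g v) r r0)).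
apply: filterS => w /[swap] Iw /(_ Iw).
rewrite gvs => -[]; rewrite /ball/= => b1 b2.
apply: contrapT => gw; apply: no; exists w; split=> //.
- by rewrite distrC.
- by rewrite distrC.
Qed.

End Interval.

Lemma gauss_curvature_neq0 (R : realType) (s : plane R -> space3 R) n p :
  gauss_curvature s n p != 0 ->
  dot (pdx (pdx s) p) n * dot (pdy (pdy s) p) n
    - dot (pdy (pdx s) p) n ^+ 2 != 0.
Proof. by apply: contra_neq => d0; rewrite /gauss_curvature d0 mul0r. Qed.

(** * The immersion, its inverse, and the Gauss map *)

Section Surface.
Variables (R : realType) (Phi : oriented_surface R).
Local Notation M := (source Phi).
Local Notation phi := (@immersion R Phi).

Lemma coord_continuous_at (i : chart M) (m : M) : dom i m ->
  {for m, continuous (Defs.coord i)}.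
Proof.
have := @Defs.coord_continuous R M i.
rewrite continuous_open_subspace; last exact: dom_open.
by move=> c mi; apply: c; rewrite inE.
Qed.

Lemma dom_near (i : chart M) (m : M) : dom i m -> \forall m' \near m, dom i m'.
Proof. by move=> mi; apply: open_nbhs_nbhs; split => //; exact: dom_open. Qed.

Lemma immersion_continuous : continuous phi.
Proof.
move=> m; have [i mi] := dom_cover m.
have ci : chart_image i (Defs.coord i m) by exists m.
have [d _ _] := @immersion_C2 R Phi i.
have c := differentiable_continuous (d _ ci).
have {}c : phi (param i (Defs.coord i m')) @[m' --> m] --> phi m.
  have E : phi m = phi (param i (Defs.coord i m)) by rewrite coordK.
  by rewrite [X in _ --> X]E; exact: continuous_comp (coord_continuous_at mi) c.
apply: cvg_trans c; apply: near_eq_cvg; near=> m' => /=.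
rewrite coordK//; near: m'; exact: dom_near.
Unshelve. all: by end_near. Qed.

(** By properness, the points outside the interior of [U] that are sent into a compact box around
    [phi m0] form a compact set; its image is closed and, by injectivity, misses [phi m0]. *)
Lemma immersion_inv_continuous (m0 : M) (U : set M) : nbhs m0 U ->
  \forall q \near phi m0, forall m, phi m = q -> U m.
Proof.
move=> U0.
set q0 := phi m0.
pose box (x : R) : set R := [set` `[x - 1, x + 1]%R].
pose K : set (space3 R) := (box q0.1.1 `*` box q0.1.2) `*` box q0.2.
have cK : compact K.
  by apply: compact_setX; [apply: compact_setX|]; exact: segment_compact.
pose K' := phi @` (phi @^-1` K `&` ~` U°).
have cK' : closed K'.
  apply: compact_closed; first exact: (@norm_hausdorff R (space3 R)).
  apply: continuous_compact.
    apply: continuous_subspaceT; exact: immersion_continuous.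
  apply: compact_closedI; first exact: immersion_proper.
  by apply: open_closedC; exact: open_interior.
have nK' : ~ K' q0.
  by move=> [m [_ nU]] /immersion_inj mm; apply: nU; rewrite mm.
have boxP (x y : R) : ball x 1 y -> box x y.
  rewrite /ball/= /box /= in_itv/= ltr_norml => /andP[h1 h2].
  by apply/andP; split; lra.
near=> q => m mq; apply: interior_subset.
apply: contrapT => nU; have : K' q.
  exists m => //; split=> //; rewrite /preimage/= mq.
  have [[b1 b2] b3] : ball q0 1 q by near: q; exact: nbhsx_ballx.
  by split; [split|]; exact: boxP.
near: q; apply: open_nbhs_nbhs; split; [exact: closed_openC|exact: nK'].
Unshelve. all: by end_near. Qed.

(* In a chart [s], a point with normal [n0] is a zero of the gradient of the
   height function [dot s n0], whose Hessian is nondegenerate; this avoids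
   differentiating the unit normal. *)
Lemma gauss_map_locally_injective (m0 : M) (n0 : space3 R) :
  nowhere_vanishing_curvature Phi -> unit_normal Phi (phi m0) = n0 ->
  \forall m \near m0, unit_normal Phi (phi m) = n0 -> m = m0.
Proof.
move=> curv n0E; have [i m0i] := dom_cover m0.
set p0 := Defs.coord i m0; pose s := phi \o param i.
have ip0 : chart_image i p0 by exists m0.
have [ds [dsu _ _] [dsv _ _]] := @immersion_C2 R Phi i.
have sp : s p0 = phi m0 by rewrite /s /= coordK.
pose G1 p := dot (pdx s p) n0; pose G2 p := dot (pdy s p) n0.
have [dG1 _] := is_diff_dot n0 (dsu _ ip0).
have [dG2 _] := is_diff_dot n0 (dsv _ ip0).
have near_image : \forall p \near p0, chart_image i p.
  by apply: open_nbhs_nbhs; split => //; exact: coord_image_open.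
(* [G1] and [G2] are the components of the gradient of the height function, whose Hessian is
   symmetric. *)
have xy : pdy G1 p0 = pdx G2 p0.
  apply: (@mixed_pd_sym R (fun p => dot (s p) n0) G1 G2 p0 _ dG1 dG2).
  near=> p; have ip : chart_image i p by near: p.
  have [dg _] := is_diff_dot n0 (ds _ ip).
  by split => //; rewrite /pdx /pdy derive_dot//; exact: ds.
have G1x : pdx G1 p0 = dot (pdx (pdx s) p0) n0 by exact/derive_dot/dsu.
have G1y : pdy G1 p0 = dot (pdy (pdx s) p0) n0 by exact/derive_dot/dsu.
have G2y : pdy G2 p0 = dot (pdy (pdy s) p0) n0 by exact/derive_dot/dsv.
have normal0 p : chart_image i p -> unit_normal Phi (s p) = n0 ->
    G1 p = 0 /\ G2 p = 0.
  move=> ip np; have orth := unit_normal_orthogonal ip; rewrite -/(s p) np in orth.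
  split.
    by rewrite /G1 dotC /pdx deriveE; [exact: orth|exact: ds].
  by rewrite /G2 dotC /pdy deriveE; [exact: orth|exact: ds].
have [G10 G20] : G1 p0 = 0 /\ G2 p0 = 0 by apply: normal0; rewrite ?sp.
have det : pdx G1 p0 * pdy G2 p0 - pdy G1 p0 * pdx G2 p0 != 0.
  (* The numerator of the curvature at [p0] is the Hessian determinant of the height function, since
     the normal there is [n0]. *)
  have : gauss_curvature s (unit_normal Phi (s p0)) p0 != 0 by exact: curv.
  rewrite sp n0E => /gauss_curvature_neq0.
  have alg (a b c d a' b' d' : R) : a = a' -> b = b' -> b = c -> d = d' ->
      a' * d' - b' ^+ 2 != 0 -> a * d - b * c != 0.
    by move=> -> <- <- ->; rewrite expr2.
  exact: alg G1x G1y xy G2y.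
have iso := zero_isolated dG1 dG2 G10 G20 det.
have : \forall m \near m0, dom i m /\
    (G1 (Defs.coord i m) = 0 -> G2 (Defs.coord i m) = 0 -> Defs.coord i m = p0).
  near=> m; split; first by near: m; exact: dom_near.
  near: m; exact: (coord_continuous_at m0i) iso.
apply: filterS => m [mi H] nm.
have [||g1 g2] := normal0 (Defs.coord i m); [by exists m|by rewrite /s/= coordK|].
by rewrite -(coordK mi) (H g1 g2); exact: coordK.
Unshelve. all: by end_near. Qed.

(** Close to a parameter where the curve is at [gamma t0], continuity of the inverse immersion keeps
    the preimages near that of [gamma t0], where no other point has the same normal. So the curve is
    locally constant there. *)
Lemma constant_normal_curve (I : interval R) (gamma : R -> space3 R) (t0 : R) :
  nowhere_vanishing_curvature Phi ->
  {within [set` I], continuous gamma} -> t0 \in I ->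
  (forall t, t \in I -> carrier Phi (gamma t)) ->
  (forall t, t \in I -> normal Phi (gamma t) = normal Phi (gamma t0)) ->
  forall t, t \in I -> gamma t = gamma t0.
Proof.
move=> curv gc It0 gPhi gn.
have hT := @norm_hausdorff R (space3 R).
apply: (constant_on_interval hT gc It0) => s Is gs.
have [m0 _ m0E] := gPhi _ Is.
have := gauss_map_locally_injective curv (erefl (unit_normal Phi (phi m0))).
move=> /immersion_inv_continuous; rewrite m0E => near_gs.
have : \forall t \near s, t \in I -> forall m, phi m = gamma t ->
    unit_normal Phi (phi m) = unit_normal Phi (gamma s) -> m = m0.
  by move/subspace_continuousP: gc => /(_ s Is _ near_gs); rewrite -?m0E.
apply: filterS => t /[swap] It /(_ It) H.
have [m _ mE] := gPhi _ It.
by rewrite -mE (H m mE) ?mE -?gs//= ?m0E// gs; exact: gn.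
Qed.

End Surface.

(** * Repeated differentiation along a circle *)

Section Circle.
Variable R : realType.

(** As [E] accumulates at each of its points, the derivative along the tangent field [(- V, U)] of a
    function vanishing on [E] vanishes on [E] too. Three applications, starting from [f] minus the
    affine function, give the three relations. *)
Lemma circle_arc_equations (D E : set (plane R)) (f : plane R -> R)
    (c1 c2 k0 al be ga : R) (e : plane R) :
  open D -> Ck 3 D f -> E `<=` D ->
  (forall q, E q -> q.1 ^+ 2 + q.2 ^+ 2 - 2 * q.1 * c1 - 2 * q.2 * c2 = k0) ->
  (forall q, E q -> f q = ga + al * q.1 + be * q.2) ->
  (forall q, E q -> forall r, 0 < r -> exists q',
     [/\ E q', q' <> q, `|q'.1 - q.1| < r & `|q'.2 - q.2| < r]) ->
  E e ->
  let U := e.1 - c1 in let V := e.2 - c2 in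
  let A := pdx f e - al in let B := pdy f e - be in
  let fxx := pdx (pdx f) e in let fxy := pdy (pdx f) e in
  let fyy := pdy (pdy f) e in
  let fxxx := pdx (pdx (pdx f)) e in let fxxy := pdy (pdx (pdx f)) e in
  let fxyy := pdy (pdy (pdx f)) e in let fyyy := pdy (pdy (pdy f)) e in
  [/\ - V * A + U * B = 0,
      V ^+ 2 * fxx - 2 * U * V * fxy + U ^+ 2 * fyy - U * A - V * B = 0 &
      - V * (V ^+ 2 * fxxx - 2 * V * fxy - 2 * U * V * fxxy + 2 * U * fyy
             + U ^+ 2 * fxyy - A - U * fxx - V * fxy)
      + U * (2 * V * fxx + V ^+ 2 * fxxy - 2 * U * fxy - 2 * U * V * fxyy
             + U ^+ 2 * fyyy - U * fxy - B - V * fyy) = 0].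
Proof.
move=> oD [df [dfx [dfxx _ _] [dfxy _ _]] [dfy _ [dfyy _ _]]] ED circ fE perf Ee.
have near_D q : D q -> \forall p \near q, D p.
  by move=> Dq; apply: open_nbhs_nbhs.
(* Mixed derivatives are brought to the order of the conclusion, with the derivatives in [x] taken
   first. *)
have fyx q : D q -> pdx (pdy f) q = pdy (pdx f) q.
  move=> Dq; apply: esym.
  apply: (@mixed_pd_sym R f (pdx f) (pdy f) q _ (dfx q Dq) (dfy q Dq)).
  apply: filterS (near_D q Dq) => p Dp; split; [exact: df|reflexivity|reflexivity].
have fxyx q : D q -> pdx (pdy (pdx f)) q = pdy (pdx (pdx f)) q.
  move=> Dq; apply: esym.
  apply: (@mixed_pd_sym R (pdx f) _ _ q _ (dfxx q Dq) (dfxy q Dq)).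
  apply: filterS (near_D q Dq) => p Dp; split; [exact: dfx|reflexivity|reflexivity].
have fyyx q : D q -> pdx (pdy (pdy f)) q = pdy (pdy (pdx f)) q.
  move=> Dq; apply: esym.
  apply: (@mixed_pd_sym R (pdy f) _ _ q _ (dfxy q Dq) (dfyy q Dq)).
  apply: filterS (near_D q Dq) => p Dp; split; [exact: dfy|exact: fyx|reflexivity].
pose u : plane R -> R := fst - cst c1.
pose v : plane R -> R := snd - cst c2.
pose A : plane R -> R := pdx f - cst al.
pose B : plane R -> R := pdy f - cst be.
have is_derive_diff (g : plane R -> R) q w : differentiable g q ->
    is_derive q w g ('D_w g q).
  by move=> dg; exact/derivableP/diff_derivable.
have du q w : is_derive q w u (w.1 - 0).
  exact: is_deriveB (is_derive_fst q w) (is_derive_cst c1 q w).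
have dv q w : is_derive q w v (w.2 - 0).
  exact: is_deriveB (is_derive_snd q w) (is_derive_cst c2 q w).
have dA q w : D q -> is_derive q w A ('D_w (pdx f) q - 0).
  move=> Dq.
  exact: is_deriveB (is_derive_diff _ q w (dfx q Dq)) (is_derive_cst al q w).
have dB q w : D q -> is_derive q w B ('D_w (pdy f) q - 0).
  move=> Dq.
  exact: is_deriveB (is_derive_diff _ q w (dfy q Dq)) (is_derive_cst be q w).
have Du q : differentiable u q.
  by have [? _] := is_diff_fst q; exact: differentiableB.
have Dv q : differentiable v q.
  by have [? _] := is_diff_snd q; exact: differentiableB.
have DA q : D q -> differentiable A q.
  by move=> Dq; apply: differentiableB => //; exact: dfx.
have DB q : D q -> differentiable B q.
  by move=> Dq; apply: differentiableB => //; exact: dfy.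
have uE q : u q = q.1 - c1 by [].
have vE q : v q = q.2 - c2 by [].
have AE q : A q = pdx f q - al by [].
have BE q : B q = pdy f q - be by [].
clearbody u v A B.
(* The conclusion holds on all of [E], so it can serve as the premise of the next application. *)
have step (g : plane R -> R) : (forall q, E q -> g q = 0) ->
    (forall q, D q -> differentiable g q) ->
    forall q, E q -> - v q * pdx g q + u q * pdy g q = 0.
  move=> g0 dg q Eq.
  rewrite uE vE; exact: (tangent_derivative0 circ g0 Eq (perf q Eq) (dg q (ED _ Eq))).
(* [H1] and [H2] are the first two derivatives of [H0] along the circle. *)
pose H0 : plane R -> R := f - (cst ga + al *: fst + be *: snd).
have H00 q : E q -> H0 q = 0.
  by move=> Eq; rewrite /H0 !fctE (fE _ Eq) subrr.
have DH0 q : D q -> differentiable H0 q.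
  have [? _] := is_diff_fst q; have [? _] := is_diff_snd q.
  move=> Dq; apply: differentiableB; first exact: df.
  apply: differentiableD; last exact: differentiableZ.
  apply: differentiableD; first exact: differentiable_cst.
  exact: differentiableZ.
have dH0 q w : D q -> 'D_w H0 q = 'D_w f q - (0 + al * w.1 + be * w.2).
  move=> Dq.
  have dl : is_derive q w (cst ga + al *: fst + be *: snd : plane R -> R)
                     (0 + al *: w.1 + be *: w.2).
    exact: is_deriveD (is_deriveD (is_derive_cst ga q w)
      (is_deriveZ al (is_derive_fst q w))) (is_deriveZ be (is_derive_snd q w)).
  have [_ E0] := is_deriveB (is_derive_diff _ q w (df q Dq)) dl.
  exact: E0.
clearbody H0.
pose H1 : plane R -> R := u * B - v * A.
have H10 q : E q -> H1 q = 0.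
  move=> Eq; have := step _ H00 DH0 q Eq; have Dq := ED _ Eq.
  have -> : pdx H0 q = A q.
    by apply: etrans (dH0 q (1, 0) Dq) _; rewrite AE /pdx /=; ring.
  have -> : pdy H0 q = B q.
    by apply: etrans (dH0 q (0, 1) Dq) _; rewrite BE /pdy /=; ring.
  by move=> <-; rewrite addrC mulNr.
have DH1 q : D q -> differentiable H1 q.
  move=> Dq; exact: differentiableB (differentiableM (Du q) (DB q Dq))
                                    (differentiableM (Dv q) (DA q Dq)).
have dH1 q w : D q -> 'D_w H1 q = u q * 'D_w (pdy f) q + w.1 * B q
                        - v q * 'D_w (pdx f) q - w.2 * A q.
  move=> Dq; have [_ E1] := is_deriveB (is_deriveM (du q w) (dB q w Dq))
                                       (is_deriveM (dv q w) (dA q w Dq)).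
  (* Function values become real variables, so that [ring] sees a polynomial identity; the left side
     has the shape produced by the product rules. *)
  have alg (u0 v0 A0 B0 Ax Bx w1 w2 : R) :
      u0 * (Bx - 0) + B0 * (w1 - 0) - (v0 * (Ax - 0) + A0 * (w2 - 0))
      = u0 * Bx + w1 * B0 - v0 * Ax - w2 * A0 by ring.
  exact: etrans E1 (alg _ _ _ _ _ _ _ _).
pose fxx := pdx (pdx f); pose fxy := pdy (pdx f); pose fyy := pdy (pdy f).
have xH1 q : D q -> pdx H1 q = u q * pdx (pdy f) q + 1 * B q
                        - v q * fxx q - 0 * A q by exact: (dH1 q (1, 0)).
have yH1 q : D q -> pdy H1 q = u q * fyy q + 0 * B q
                        - v q * fxy q - 1 * A q by exact: (dH1 q (0, 1)).
have H1E q : H1 q = u q * B q - v q * A q by [].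
clearbody H1.
pose uv : plane R -> R := u * v.
pose H2 : plane R -> R := v * v * fxx - (uv * fxy + uv * fxy)
                          + u * u * fyy - u * A - v * B.
have H2E q : H2 q = v q ^+ 2 * fxx q - 2 * u q * v q * fxy q + u q ^+ 2 * fyy q
                    - u q * A q - v q * B q.
  rewrite /H2 /uv !fctE.
  move: (u q) (v q) (A q) (B q) (fxx q) (fxy q) (fyy q) => *; ring.
have H20 q : E q -> H2 q = 0.
  move=> Eq; have := step _ H10 DH1 q Eq; have Dq := ED _ Eq.
  rewrite xH1// yH1// fyx// -/(fxy q) H2E => <-.
  move: (u q) (v q) (A q) (B q) (fxx q) (fxy q) (fyy q) => *; ring.
have DH2 q : D q -> differentiable H2 q.
  move=> Dq; have Duv := differentiableM (Du q) (Dv q).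
  have Duvf := differentiableM Duv (dfxy q Dq).
  apply: differentiableB (differentiableM (Dv q) (DB q Dq)).
  apply: differentiableB (differentiableM (Du q) (DA q Dq)).
  apply: differentiableD (differentiableM (differentiableM (Du q) (Du q)) (dfyy q Dq)).
  apply: differentiableB (differentiableD Duvf Duvf).
  exact: differentiableM (differentiableM (Dv q) (Dv q)) (dfxx q Dq).
have dH2 q w : D q -> 'D_w H2 q =
    v q ^+ 2 * 'D_w fxx q + 2 * v q * w.2 * fxx q
    - 2 * (u q * v q * 'D_w fxy q + (u q * w.2 + v q * w.1) * fxy q)
    + u q ^+ 2 * 'D_w fyy q + 2 * u q * w.1 * fyy q
    - u q * 'D_w (pdx f) q - w.1 * A q - v q * 'D_w (pdy f) q - w.2 * B q.
  move=> Dq.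
  have duvf := is_deriveM (is_deriveM (du q w) (dv q w))
                          (is_derive_diff _ q w (dfxy q Dq)).
  have dvvf := is_deriveM (is_deriveM (dv q w) (dv q w))
                          (is_derive_diff _ q w (dfxx q Dq)).
  have duuf := is_deriveM (is_deriveM (du q w) (du q w))
                          (is_derive_diff _ q w (dfyy q Dq)).
  have duA := is_deriveM (du q w) (dA q w Dq).
  have dvB := is_deriveM (dv q w) (dB q w Dq).
  have [_ E2] := is_deriveB (is_deriveB (is_deriveD
     (is_deriveB dvvf (is_deriveD duvf duvf)) duuf) duA) dvB.
  have alg (u0 v0 A0 B0 Ax Bx a b c a' b' c' w1 w2 : R) :
      v0 * v0 * a' + a * (v0 * (w2 - 0) + v0 * (w2 - 0))
      - (u0 * v0 * b' + b * (u0 * (w2 - 0) + v0 * (w1 - 0))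
         + (u0 * v0 * b' + b * (u0 * (w2 - 0) + v0 * (w1 - 0))))
      + (u0 * u0 * c' + c * (u0 * (w1 - 0) + u0 * (w1 - 0)))
      - (u0 * (Ax - 0) + A0 * (w1 - 0)) - (v0 * (Bx - 0) + B0 * (w2 - 0)) =
      v0 ^+ 2 * a' + 2 * v0 * w2 * a - 2 * (u0 * v0 * b' + (u0 * w2 + v0 * w1) * b)
      + u0 ^+ 2 * c' + 2 * u0 * w1 * c - u0 * Ax - w1 * A0 - v0 * Bx - w2 * B0.
    by ring.
  exact: etrans E2 (alg _ _ _ _ _ _ _ _ _ _ _ _ _ _).
have xH2 : D e -> pdx H2 e =
    v e ^+ 2 * pdx fxx e + 2 * v e * 0 * fxx e
    - 2 * (u e * v e * pdx fxy e + (u e * 0 + v e * 1) * fxy e)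
    + u e ^+ 2 * pdx fyy e + 2 * u e * 1 * fyy e
    - u e * fxx e - 1 * A e - v e * pdx (pdy f) e - 0 * B e by exact: (dH2 e (1, 0)).
have yH2 : D e -> pdy H2 e =
    v e ^+ 2 * pdy fxx e + 2 * v e * 1 * fxx e
    - 2 * (u e * v e * pdy fxy e + (u e * 1 + v e * 0) * fxy e)
    + u e ^+ 2 * pdy fyy e + 2 * u e * 0 * fyy e
    - u e * fxy e - 0 * A e - v e * fyy e - 1 * B e by exact: (dH2 e (0, 1)).
clearbody H2.
have De := ED _ Ee.
have fyx' : pdx (pdy f) e = fxy e := fyx e De.
have fxyx' : pdx fxy e = pdy fxx e := fxyx e De.
have fyyx' : pdx fyy e = pdy fxy e := fyyx e De.
have fxxE : fxx = pdx (pdx f) := erefl _.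
have fxyE : fxy = pdy (pdx f) := erefl _.
have fyyE : fyy = pdy (pdy f) := erefl _.
have H1e : - v e * A e + u e * B e = 0.
  by rewrite addrC mulNr -H1E; exact: H10.
have H2e : v e ^+ 2 * fxx e - 2 * u e * v e * fxy e + u e ^+ 2 * fyy e
           - u e * A e - v e * B e = 0.
  by rewrite -H2E; exact: H20.
(* The third application, which brings in the third derivatives of [f]. *)
have := step _ H20 DH2 e Ee.
rewrite (xH2 De) (yH2 De) {xH2 yH2 dH2 DH2 H20 H2E H2}.
clear xH1 yH1 fyx fxyx fyyx dfxx dfxy dfyy.
clearbody fxx fxy fyy.
rewrite fxyx' fyyx' fyx' => H3e.
have {}H3e : - v e * (v e ^+ 2 * pdx fxx e - 2 * v e * fxy e
    - 2 * u e * v e * pdy fxx e + 2 * u e * fyy e + u e ^+ 2 * pdy fxy e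
    - A e - u e * fxx e - v e * fxy e)
  + u e * (2 * v e * fxx e + v e ^+ 2 * pdy fxx e - 2 * u e * fxy e
    - 2 * u e * v e * pdy fxy e + u e ^+ 2 * pdy fyy e - u e * fxy e - B e
    - v e * fyy e) = 0.
  rewrite -H3e; ring.
rewrite uE vE AE BE fxxE fxyE fyyE in H1e H2e H3e.
exact: And3 H1e H2e H3e.
Qed.

End Circle.

(** * Stereographic projection of normals and the tangent planes of a cylinder *)

Section Cylinder.
Variable R : realType.
Implicit Types (a w q n m : space3 R).

Lemma open_disk (c : plane R) (r : R) : open (disk c r).
Proof.
have cc : continuous (fun p : plane R => (p.1 - c.1) ^+ 2 + (p.2 - c.2) ^+ 2).
  move=> p; apply: cvgD; rewrite /continuous_at; under eq_fun do rewrite expr2.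
    by apply: cvgM; apply: cvgB (cvg_cst _); exact: cvg_fst.
  by apply: cvgM; apply: cvgB (cvg_cst _); exact: cvg_snd.
apply: (@open_comp _ _ (fun p : plane R => (p.1 - c.1) ^+ 2 + (p.2 - c.2) ^+ 2)
  [set z | z < r ^+ 2]); last exact: open_lt.
by move=> p _; exact: cc.
Qed.

Lemma enorm_eqE (u : space3 R) (r : R) : 0 <= r -> enorm u = r -> dot u u = r ^+ 2.
Proof.
move=> r0 <-; rewrite sqr_sqrtr// /dot.
by rewrite !addr_ge0// -expr2 sqr_ge0.
Qed.

(* The first two coordinates of the isotropic point of a plane with normal [n]. *)
Definition gauss_plane n : plane R := (n.1.1 / (n.2 + 1), n.1.2 / (n.2 + 1)).

Lemma dot_neq_south n : dot n n = 1 -> n <> south R -> n.2 + 1 != 0.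
Proof.
case: n => -[n1 n2] n3; rewrite /dot /= => n_unit ns.
apply/negP => /eqP n3E; apply: ns.
have {}n3E : n3 = -1 by lra.
move: n_unit; rewrite n3E => n_unit.
have : n1 ^+ 2 + n2 ^+ 2 == 0 by apply/eqP; lra.
by rewrite paddr_eq0 ?sqr_ge0// !sqrf_eq0 => /andP[/eqP -> /eqP ->].
Qed.

Lemma gauss_plane_sqr n : dot n n = 1 -> n.2 + 1 != 0 ->
  (gauss_plane n).1 ^+ 2 + (gauss_plane n).2 ^+ 2 = 2 / (n.2 + 1) - 1.
Proof.
rewrite /dot /gauss_plane /= => n_unit n3.
have -> : (n.1.1 / (n.2 + 1)) ^+ 2 + (n.1.2 / (n.2 + 1)) ^+ 2 =
  (n.1.1 * n.1.1 + n.1.2 * n.1.2 + n.2 * n.2 - n.2 ^+ 2) / (n.2 + 1) ^+ 2.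
  by field.
by rewrite n_unit; field.
Qed.

(** [gauss_plane] is stereographic projection from the south pole: the norm of the image determines
    the last coordinate, and then the image determines the other two. *)
Lemma gauss_plane_inj n m : dot n n = 1 -> dot m m = 1 ->
  n.2 + 1 != 0 -> m.2 + 1 != 0 -> gauss_plane n = gauss_plane m -> n = m.
Proof.
move=> n_unit m_unit n3 m3 nm.
have := gauss_plane_sqr m_unit m3; rewrite -nm (gauss_plane_sqr n_unit n3).
have two_neq0 : 2 != 0 :> R by rewrite pnatr_eq0.
move=> /(addIr _)/(mulfI two_neq0)/invr_inj/(addIr _) E3.
case: nm; rewrite E3 => /(mulIf (invr_neq0 m3)) E1 /(mulIf (invr_neq0 m3)) E2.
by rewrite (surjective_pairing n) (surjective_pairing n.1) E1 E2 E3;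
   case: (m) => -[].
Qed.

Variables (a w : space3 R) (r : R).
Hypotheses (w_unit : enorm w = 1) (w3 : w.2 != 0) (r_gt0 : 0 < r).
Let S := inward_cylinder a w r.

(** The vector [axis_proj a w q - q] is [r] times the normal, and is orthogonal to [w] because [w]
    is a unit vector. As [axis_proj a w q - a] is a multiple of [w], pairing with the normal gives
    the last equation. *)
Lemma inward_cylinder_facts q : carrier S q ->
  [/\ dot (normal S q) (normal S q) = 1, dot (normal S q) w = 0 &
      dot (normal S q) q = dot (normal S q) a - r].
Proof.
move=> Sq; have Sq2 := enorm_eqE (ltW r_gt0) Sq.
have w2 := enorm_eqE ler01 w_unit.
have rn0 : r != 0 by rewrite gt_eqF.
have nE : normal S q = r^-1 *: (axis_proj a w q - q) by [].
have nn : dot (normal S q) (normal S q) = 1.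
  rewrite nE (_ : dot _ _ = r^-1 ^+ 2
    * dot (q - axis_proj a w q) (q - axis_proj a w q)).
    by rewrite Sq2 -exprMn mulVf// expr1n.
  rewrite /dot /= /GRing.scale /=; ring.
have nw : dot (normal S q) w = 0.
  rewrite nE (_ : dot _ _ = r^-1 * dot (q - a) w * (dot w w - 1)).
    by rewrite w2 expr1n subrr mulr0.
  by rewrite /axis_proj /dot /= /GRing.scale /=; ring.
split=> //.
have -> : dot (normal S q) a = dot (normal S q) q + r * dot (normal S q) (normal S q)
                               - dot (q - a) w * dot (normal S q) w.
  by rewrite {3}nE /axis_proj /dot /= /GRing.scale/=; field.
by rewrite nn nw; ring.
Qed.

(** The normals lie on the great circle orthogonal to [w], which avoids the south pole as
    [w.2 != 0]; hence its stereographic image is a circle, centred at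
    [(w.1.1 / w.2, w.1.2 / w.2)]. *)
Lemma inward_cylinder_circle q : carrier S q -> (normal S q).2 + 1 != 0 ->
  let p := gauss_plane (normal S q) in
  p.1 ^+ 2 + p.2 ^+ 2 - 2 * p.1 * (w.1.1 / w.2) - 2 * p.2 * (w.1.2 / w.2) = 1.
Proof.
move=> Sq; have [n_unit nw _] := inward_cylinder_facts Sq.
move: (normal S q) n_unit nw => n n_unit nw n3.
rewrite /= (gauss_plane_sqr n_unit n3) /gauss_plane /=.
transitivity (1 - 2 * (n.1.1 * w.1.1 + n.1.2 * w.1.2 + n.2 * w.2)
              / ((n.2 + 1) * w.2)).
  by field; rewrite ?w3 ?n3.
by rewrite [X in 2 * X]nw mulr0 mul0r subr0.
Qed.

(** The offset of the tangent plane is [r - dot n a] for the normal [n], and orthogonality of [n] to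
    [w] makes [1 / (n.2 + 1)] and [n.2 / (n.2 + 1)] affine in [p]. The constant term is the radius,
    whatever the axis. *)
Lemma inward_cylinder_height q : carrier S q -> (normal S q).2 + 1 != 0 ->
  let p := gauss_plane (normal S q) in
  - dot (normal S q) q / ((normal S q).2 + 1) =
  r + (r * (w.1.1 / w.2) - a.1.1 + a.2 * (w.1.1 / w.2)) * p.1
    + (r * (w.1.2 / w.2) - a.1.2 + a.2 * (w.1.2 / w.2)) * p.2.
Proof.
move=> Sq; have [n_unit nw ->] := inward_cylinder_facts Sq.
move: (normal S q) n_unit nw => n n_unit nw n3.
rewrite /gauss_plane /=; apply/eqP; rewrite -subr_eq0; apply/eqP.
transitivity (- (r + a.2) * (n.1.1 * w.1.1 + n.1.2 * w.1.2 + n.2 * w.2)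
              / ((n.2 + 1) * w.2)).
  by rewrite /dot; field; rewrite ?w3 ?n3.
by rewrite [X in _ * X / _]nw mulr0 mul0r.
Qed.

(** The normal field of the cylinder is an affine map of the whole space, so it carries continuity
    of the contact curve over to its projection. *)
Lemma inward_cylinder_gauss_continuous q : (normal S q).2 + 1 != 0 ->
  {for q, continuous (fun q => gauss_plane (normal S q))}.
Proof.
move=> n3.
have cn : continuous (normal S : space3 R -> space3 R).
  move=> x; apply: cvgZr; apply: cvgB; last exact: cvg_id.
  apply: cvgD; first exact: cvg_cst.
  apply: cvgZl.
  have ca : continuous (fun y : space3 R => y - a).
    by move=> y; apply: cvgB; [exact: cvg_id|exact: cvg_cst].
  exact: (continuous_comp (ca x) (@dot_continuous R w (x - a))).
have c2 : continuous (fun q => (normal S q).2).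
  by move=> x; exact: (continuous_comp (cn x) (@cvg_snd _ _ _ _ _)).
have c1 : continuous (fun q => (normal S q).1).
  by move=> x; exact: (continuous_comp (cn x) (@cvg_fst _ _ _ _ _)).
have c11 : continuous (fun q => (normal S q).1.1).
  by move=> x; exact: (continuous_comp (c1 x) (@cvg_fst _ _ _ _ _)).
have c12 : continuous (fun q => (normal S q).1.2).
  by move=> x; exact: (continuous_comp (c1 x) (@cvg_snd _ _ _ _ _)).
have cV : {for q, continuous (fun q => ((normal S q).2 + 1)^-1)}.
  apply: cvgV => //; apply: cvgD; [exact: c2|exact: cvg_cst].
exact: cvg_pair (cvgM (c11 q) cV) (cvgM (c12 q) cV).
Qed.

End Cylinder.

(** * Elimination of the affine function, and the conclusion *)

Lemma CkW (R : realType) (V : normedModType R) (k : nat) (D : set (plane R))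
    (f : plane R -> V) : Ck k.+1 D f -> Ck k D f.
Proof.
elim: k f => [|k IH] f [df fx fy].
  by move=> p Dp; exact/differentiable_continuous/df.
by split; [exact: df|exact: IH fx|exact: IH fy].
Qed.

(** With [u = - U] and [v = - V], the cubic equation is the sum of the third and first relations,
    and the second equation is that of the circle. *)
Lemma tangent_circle_algebra (R : realType) (x y c1 c2 al be r : R)
    (fx fy fxx fxy fyy fxxx fxxy fxyy fyyy : R) :
  x ^+ 2 + y ^+ 2 - 2 * x * c1 - 2 * y * c2 = 1 ->
  let U := x - c1 in let V := y - c2 in
  let A := fx - al in let B := fy - be in
  - V * A + U * B = 0 ->
  V ^+ 2 * fxx - 2 * U * V * fxy + U ^+ 2 * fyy - U * A - V * B = 0 ->
  - V * (V ^+ 2 * fxxx - 2 * V * fxy - 2 * U * V * fxxy + 2 * U * fyy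
         + U ^+ 2 * fxyy - A - U * fxx - V * fxy)
  + U * (2 * V * fxx + V ^+ 2 * fxxy - 2 * U * fxy - 2 * U * V * fxyy
         + U ^+ 2 * fyyy - U * fxy - B - V * fyy) = 0 ->
  let u := c1 - x in let v := c2 - y in
  [/\ fxxx * v ^+ 3 - 3 * fxxy * v ^+ 2 * u + 3 * fxyy * v * u ^+ 2
        - fyyy * u ^+ 3 + 3 * (fxx - fyy) * u * v
        + 3 * fxy * (v ^+ 2 - u ^+ 2) = 0,
      x ^+ 2 + y ^+ 2 + 1 + 2 * x * u + 2 * y * v = 0 &
      2 * (u ^+ 2 + v ^+ 2) * (r + al * x + be * y - x * fx - y * fy - r)
        + (x ^+ 2 + y ^+ 2 + 1)
          * (fxx * v ^+ 2 - 2 * fxy * u * v + fyy * u ^+ 2) = 0].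
Proof.
move=> circ U V A B eq1 eq2 eq3 u v; split.
- transitivity ((- V * (V ^+ 2 * fxxx - 2 * V * fxy - 2 * U * V * fxxy + 2 * U * fyy
         + U ^+ 2 * fxyy - A - U * fxx - V * fxy)
    + U * (2 * V * fxx + V ^+ 2 * fxxy - 2 * U * fxy - 2 * U * V * fxyy
         + U ^+ 2 * fyyy - U * fxy - B - V * fyy)) + (- V * A + U * B)).
    by rewrite /u /v /U /V /A /B; ring.
  by rewrite eq3 eq1 addr0.
- transitivity (1 - (x ^+ 2 + y ^+ 2 - 2 * x * c1 - 2 * y * c2)).
    by rewrite /u /v; ring.
  by rewrite circ subrr.
(* The factor containing the radius is [- (x A + y B)]. Its product with [U ^ 2 + V ^ 2] is split by
   [(x U + y V) (U A + V B) + (U y - V x) (U B - V A)], and the circle equation says that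
   [2 (x U + y V)] is [x ^ 2 + y ^ 2 + 1]. *)
transitivity (- 2 * (U * y - V * x) * (- V * A + U * B)
  + (x ^+ 2 + y ^+ 2 + 1) *
    (V ^+ 2 * fxx - 2 * U * V * fxy + U ^+ 2 * fyy - U * A - V * B)
  - (x ^+ 2 + y ^+ 2 - 2 * x * c1 - 2 * y * c2 - 1) * (U * A + V * B)).
  by rewrite /u /v /U /V /A /B; ring.
by rewrite eq1 eq2 circ subrr; ring.
Qed.

Theorem corollary25 (R : realType) (Phi : oriented_surface R)
    (c : plane R) (rho : R) (f : plane R -> R) (rad : R)
    (rho_gt0 : 0 < rho) (rad_gt0 : 0 < rad)
    (curvature_Phi : nowhere_vanishing_curvature Phi)
    (normal_Phi : forall q, carrier Phi q -> normal Phi q <> south R)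
    (f_C4 : Ck 4 (disk c rho) f)
    (graph_Phi : isotropic_image Phi = graph_on (disk c rho) f)
    (cylinders : forall q, carrier Phi q ->
       exists (a w : space3 R) (C : set (space3 R)),
         [/\ enorm w = 1, w.2 != 0, continuous_curve C, C q &
             tangent_along (inward_cylinder a w rad) Phi C]) :
  forall x y : R, disk c rho (x, y) ->
    let fx := pdx f (x, y) in
    let fy := pdy f (x, y) in
    let fxx := pdx (pdx f) (x, y) in
    let fxy := pdy (pdx f) (x, y) in
    let fyy := pdy (pdy f) (x, y) in
    let fxxx := pdx (pdx (pdx f)) (x, y) in
    let fxxy := pdy (pdx (pdx f)) (x, y) in
    let fxyy := pdy (pdy (pdx f)) (x, y) in
    let fyyy := pdy (pdy (pdy f)) (x, y) in
    exists u v : R,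
      [/\ fxxx * v ^+ 3 - 3 * fxxy * v ^+ 2 * u + 3 * fxyy * v * u ^+ 2
            - fyyy * u ^+ 3 + 3 * (fxx - fyy) * u * v
            + 3 * fxy * (v ^+ 2 - u ^+ 2) = 0,
          x ^+ 2 + y ^+ 2 + 1 + 2 * x * u + 2 * y * v = 0 &
          2 * (u ^+ 2 + v ^+ 2) * (f (x, y) - x * fx - y * fy - rad)
            + (x ^+ 2 + y ^+ 2 + 1)
              * (fxx * v ^+ 2 - 2 * fxy * u * v + fyy * u ^+ 2) = 0].
Proof.
move=> x y Dxy.
have unitP q : carrier Phi q -> dot (normal Phi q) (normal Phi q) = 1.
  by move=> /unit_normal_unit /(enorm_eqE ler01); rewrite expr1n.
have n3P q : carrier Phi q -> (normal Phi q).2 + 1 != 0.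
  by move=> Pq; apply: dot_neq_south; [exact: unitP|exact: normal_Phi].
(* A graph has a single point over each [p], so the third isotropic coordinate must be the value of
   [f]. *)
have isoP q : carrier Phi q -> disk c rho (gauss_plane (normal Phi q)) /\
    f (gauss_plane (normal Phi q)) = - dot (normal Phi q) q / ((normal Phi q).2 + 1).
  move=> Pq.
  have : isotropic_image Phi (isotropic_point (tangent_plane Phi q)).
    by exists q => //; split=> //; exact: normal_Phi.
  rewrite graph_Phi => -[p Dp [pE <-]].
  by have -> : gauss_plane (normal Phi q) = p by rewrite pE.
have [q Pq qE] : exists2 q, carrier Phi q & gauss_plane (normal Phi q) = (x, y).
  have : graph_on (disk c rho) f (x, y, f (x, y)) by exists (x, y).
  rewrite -graph_Phi => -[q [Pq _] [E1 E2 _]].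
  by exists q => //; rewrite /gauss_plane E1 E2.
have [a [w [C [w_unit w3 [I [gamma [gc [s1 [s2 [Is1 Is2 g12]]] CE]]] Cq]]]] :=
  cylinders q Pq.
move=> [CS CPhi tangent].
set S := inward_cylinder a w rad in CS tangent.
have gC t : t \in I -> C (gamma t) by move=> It; rewrite CE; exists t.
have gPhi t (It : t \in I) : carrier Phi (gamma t) := CPhi _ (gC t It).
have nE t : t \in I -> normal Phi (gamma t) = normal S (gamma t).
  by move=> /gC/tangent[].
have n3S t : t \in I -> (normal S (gamma t)).2 + 1 != 0.
  by move=> It; rewrite -nE//; exact/n3P/gPhi.
have [t0 It0 t0E] : exists2 t, t \in I & gamma t = q.
  by move: Cq; rewrite CE => -[t It <-]; exists t.
(* The projected contact curve, expressed by the normal of the cylinder, which agrees with that of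
   [Phi] along the curve. *)
pose mu t := gauss_plane (normal S (gamma t)).
have muc : {within [set` I], continuous mu}.
  apply/subspace_continuousP => t It.
  have gt : gamma @ within [set` I] (nbhs t) --> gamma t.
    by move/subspace_continuousP: gc => /(_ t It).
  exact: (cvg_comp _ _ gt (inward_cylinder_gauss_continuous (n3S t It))).
(* If [mu] were constant, the normal of [Phi] would be constant along the curve by injectivity of
   the projection, and the curve would reduce to a point. *)
have mu_nonconst : exists s t, [/\ s \in I, t \in I & mu s <> mu t].
  apply: contrapT => mu_const; apply: g12.
  suff gconst t : t \in I -> gamma t = gamma t0 by rewrite !gconst.
  apply: (constant_normal_curve curvature_Phi gc It0 gPhi) => {}t It.
  have [Pt Pt0] := (gPhi t It, gPhi t0 It0).
  apply: (gauss_plane_inj (unitP _ Pt) (unitP _ Pt0) (n3P _ Pt) (n3P _ Pt0)).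
  apply: contrapT => mu_t; apply: mu_const; exists t, t0; split=> //.
  by rewrite /mu -!nE.
pose c1 := w.1.1 / w.2; pose c2 := w.1.2 / w.2.
(* The coefficients supplied by [inward_cylinder_height]. *)
pose al := rad * c1 - a.1.1 + a.2 * c1; pose be := rad * c2 - a.1.2 + a.2 * c2.
pose E := mu @` [set` I].
have circ p : E p -> p.1 ^+ 2 + p.2 ^+ 2 - 2 * p.1 * c1 - 2 * p.2 * c2 = 1.
  move=> [t It <-]; apply: (inward_cylinder_circle w_unit w3 rad_gt0).
    exact/CS/gC.
  exact: n3S.
have fE p : E p -> f p = rad + al * p.1 + be * p.2.
  move=> [t It <-]; rewrite /mu -(nE t It).
  have [_ ->] := isoP _ (gPhi t It); rewrite (nE t It).
  apply: (inward_cylinder_height w_unit w3 rad_gt0).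
    exact/CS/gC.
  exact: n3S.
have ED : E `<=` disk c rho.
  by move=> p [t It <-]; rewrite /mu -nE//; have [] := isoP _ (gPhi t It).
have perf p : E p -> forall r, 0 < r -> exists p',
    [/\ E p', p' <> p, `|p'.1 - p.1| < r & `|p'.2 - p.2| < r].
  move=> [t It <-] r r0.
  have [t' [It' ne d1 d2]] := interval_image_perfect muc mu_nonconst It r0.
  by exists (mu t'); split=> //; exists t'.
have Exy : E (x, y) by exists t0 => //; rewrite /mu -nE// t0E.
have [] := circle_arc_equations (@open_disk R c rho) (CkW f_C4) ED circ fE perf Exy.
have := circ _ Exy; have := fE _ Exy.
rewrite /= => fxyE circxy eq1 eq2 eq3.
exists (c1 - x), (c2 - y); rewrite fxyE.
exact: tangent_circle_algebra circxy eq1 eq2 eq3.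
Qed.
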